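(* Let $A$ be a finite Abelian group of order $p_1^{\alpha_1}p_2^{\alpha_2}\cdots p_n^{\alpha_n}$ (prime factorization with distinct primes $p_i$). Then $g(A)\geq f(A)\geq 1+\sum_{i=1}^n \alpha_i$.
   Context: A coset covering (subgroup covering) of a group $G$ is a collection of cosets of subgroups of $G$ (of subgroups of $G$) whose union is $G$. A covering is irredundant if none of its members can be omitted. For a finite group $G$, $f(G)$ denotes the minimal $k$ such that there exists an irredundant covering of $G$ by $k$ cosets $\{H_ix_i \mid i=1,\dots,k\}$ (with $H_i\le G$, $x_i\in G$) for which $\bigcap_i H_i$ is trivial. $g(G)$ denotes the minimal $k$ such that there exists an irredundant covering of $G$ by $k$ subgroups $\{H_i\mid i=1,\dots,k\}$ for which $\bigcap_i H_i$ is trivial; if there is no such subgroup covering, $g(G)=\infty$. *)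

(* Defs.v *)
From mathcomp Require Import all_boot all_order all_algebra all_fingroup.
From mathcomp Require Import boolp constructive_ereal.

Set Implicit Arguments.
Unset Strict Implicit.
Unset Printing Implicit Defensive.

Local Open Scope group_scope.

Section Coverings.
Variable gT : finGroupType.
Implicit Types G : {group gT}.

Definition covering G k (F : 'I_k -> {set gT}) : bool :=
  \bigcup_(i < k) F i == G.

Definition irredundant_covering G k (F : 'I_k -> {set gT}) : bool :=
  covering G F && [forall j : 'I_k, \bigcup_(i < k | i != j) F i != G].

(* For k = 0 the intersection below is the full set of gT rather than that of
   G, which is harmless: the empty family is never a covering. *)
Definition has_coset_covering G (k : nat) : bool :=
  [exists H : {ffun 'I_k -> {group gT}}, exists x : {ffun 'I_k -> gT},
    [&& [forall i, (H i \subset G) && (x i \in G)],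
        irredundant_covering G (fun i => H i :* x i)
      & \bigcap_(i < k) H i == 1]].

Definition has_subgroup_covering G (k : nat) : bool :=
  [exists H : {ffun 'I_k -> {group gT}},
    [&& [forall i, H i \subset G],
        irredundant_covering G (fun i => H i)
      & \bigcap_(i < k) H i == 1]].

(* Witness: the cosets of the trivial subgroup. *)
Lemma coset_covering_exists G : exists k, has_coset_covering G k.
Proof.
have e1 : 1 \in G by [].
exists #|G|; apply/existsP; exists [ffun=> 1%G].
apply/existsP; exists [ffun i => enum_val i].
apply/and3P; split.
- by apply/forallP => i; rewrite !ffunE sub1G enum_valP.
- apply/andP; split.
    apply/eqP/setP => y; apply/bigcupP/idP => [[i _]|Gy].
      by rewrite !ffunE mul1g => /set1P->; apply: enum_valP.
    exists (enum_rank_in e1 y) => //.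
    by rewrite !ffunE mul1g enum_rankK_in // set11.
  apply/forallP => j; apply/eqP => /setP/(_ (enum_val j)).
  rewrite enum_valP => /bigcupP[i /eqP nij].
  by rewrite !ffunE mul1g => /set1P/enum_val_inj/esym.
- rewrite eqEsubset; apply/andP; split.
    apply: subset_trans (bigcap_inf (enum_rank_in e1 1) _) _ => //.
    by rewrite ffunE.
  by apply/bigcapsP => i _; rewrite ffunE.
Qed.

Definition f G : nat := ex_minn (coset_covering_exists G).

Definition g G : \bar int :=
  if pselect (exists k, has_subgroup_covering G k) is left gP
  then ((ex_minn gP)%:Z)%:E else +oo%E.

End Coverings.

(* Main.v *)
Require Import Defs.
From mathcomp Require Import all_boot all_order all_algebra all_fingroup.
From mathcomp Require Import boolp constructive_ereal.
From mathcomp Require Import all_solvable.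

(** Write Omega for the number of prime factors counted with multiplicity. By
    induction on the order of an abelian group B, if the cosets H_j x_j, j in J,
    irredundantly cover a coset of B, and D_I is the intersection of B with the
    H_i, i in I, then Omega |B : D_J| < |J|. Starting from j in J, choose a
    subgroup M of prime index in B containing the part of H_j in B; some coset
    of M misses H_j x_j, hence is irredundantly covered by the members of some
    I included in J \ j, and induction for M gives Omega |B : D_I| <= |I|. As
    long as I <> J, irredundancy provides a coset of D_I that meets no member
    of I; induction for D_I enlarges I by a set I' while Omega |B : D_I|
    increases by less than |I'|. *)

Set Implicit Arguments.
Unset Strict Implicit.
Unset Printing Implicit Defensive.

Local Open Scope group_scope.

(** [logn q m] is 0 unless [q] is prime, so [q] may run over all numbers up to [m]. *)
Definition Omega (m : nat) : nat := \sum_(q < m.+1) logn q m.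

Lemma Omega_widen m N : 0 < m <= N -> Omega m = \sum_(q < N.+1) logn q m.
Proof.
case/andP=> m_gt0 le_mN; rewrite /Omega (big_ord_widen N.+1 (logn^~ m)) //.
rewrite big_mkcond; apply: eq_bigr => q _; case: ltnP => // lt_mq.
by rewrite /= ltn_log0.
Qed.

Lemma OmegaM m n : 0 < m -> 0 < n -> Omega (m * n) = (Omega m + Omega n)%N.
Proof.
move=> m_gt0 n_gt0; rewrite (@Omega_widen m (m * n)) ?m_gt0 ?leq_pmulr //.
rewrite (@Omega_widen n (m * n)) ?n_gt0 ?leq_pmull // -big_split.
by apply: eq_bigr => q _; rewrite lognM.
Qed.

Lemma Omega1 : Omega 1 = 0%N.
Proof. by rewrite /Omega big1 // => q _; rewrite logn1. Qed.

Lemma Omega_prime q : prime q -> Omega q = 1%N.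
Proof.
move=> q_pr; rewrite /Omega (bigD1 ord_max) //= logn_prime // eqxx big1 // => i.
by rewrite logn_prime // -val_eqE eq_sym /= => /negPf->.
Qed.

Lemma OmegaX m e : 0 < m -> Omega (m ^ e) = (e * Omega m)%N.
Proof.
move=> m_gt0; elim: e => [|e IHe]; first by rewrite expn0 Omega1.
by rewrite expnS OmegaM ?expn_gt0 ?m_gt0 // IHe mulSn.
Qed.

Lemma Omega_prod I (r : seq I) (F : I -> nat) :
    (forall i, 0 < F i) ->
  Omega (\prod_(i <- r) F i) = (\sum_(i <- r) Omega (F i))%N.
Proof.
move=> F_gt0; elim: r => [|i r IHr]; first by rewrite !big_nil Omega1.
by rewrite !big_cons OmegaM // ?IHr // prodn_gt0.
Qed.

Section CosetCoverings.
Variables (gT : finGroupType) (T : finType).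
Variables (H : T -> {group gT}) (x : T -> gT).
Implicit Types (B M : {group gT}) (I J K : {set T}).

Lemma Omega_indexgM B M (N : {group gT}) : N \subset M -> M \subset B ->
  Omega #|B : N| = (Omega #|B : M| + Omega #|M : N|)%N.
Proof.
by move=> sNM sMB; rewrite -(Lagrange_index sMB sNM) OmegaM // mulnC.
Qed.

(** [M] is normal, so by maximality the quotient is simple; being solvable too, it has prime
    order. *)
Lemma maximal_abelian_index_prime B M :
  abelian B -> maximal M B -> prime #|B : M|.
Proof.
move=> abB maxM; have [ltMB maxP] := maxgroupP maxM.
have nsMB : M <| B by rewrite -sub_abelian_normal // proper_sub.
rewrite -card_quotient ?normal_norm //; apply: simple_sol_prime.
  by rewrite quotient_sol // abelian_sol.
rewrite quotient_simple //; apply/maxgroupP; split=> [|N /andP[ltNB _]].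
  by rewrite ltMB normal_norm.
exact: maxP.
Qed.

(** The group D_J: left translation by its elements preserves every coset [H i :* x i] with
    [i \in J]. *)
Definition cap_stab B J : {group gT} := (B :&: \bigcap_(i in J) H i)%G.

Lemma cap_stabS B I J : I \subset J -> cap_stab B J \subset cap_stab B I.
Proof.
move=> sIJ; apply: setIS; apply/bigcapsP=> i Ii.
by apply: bigcap_inf; apply: (subsetP sIJ).
Qed.

Lemma cap_stabU B I J : cap_stab (cap_stab B I) J = cap_stab B (I :|: J).
Proof. by apply: val_inj; rewrite /= bigcap_setU setIA. Qed.

(** Stated as a predicate on index sets so that [minset (covers E) J] expresses irredundancy. *)
Definition covers (E : {set gT}) : pred {set T} :=
  fun J => E \subset \bigcup_(i in J) (H i :* x i).

(** Minimality yields a point [w] of [B :* y] that only the [i]-th coset covers; both cosets can be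
    based at [w]. *)
Lemma minset_covers_meet B y J i :
  minset (covers (B :* y)) J -> i \in J ->
  exists2 w, B :* y = B :* w & H i :* x i = H i :* w.
Proof.
case/minsetP=> covJ minJ Ji.
have /subsetPn[w Byw Jw] : ~~ covers (B :* y) (J :\ i).
  by apply/negP=> /minJ/(_ (subD1set _ _))/setP/(_ i); rewrite !inE eqxx Ji.
exists w; first exact/esym/rcoset_eqP.
apply/esym/rcoset_eqP; have /bigcupP[j Jj Cjw] := subsetP covJ w Byw.
have [<- //|neji] := eqVneq j i.
by case/bigcupP: Jw; exists j; rewrite // !inE neji.
Qed.

Lemma minset_covers_sub B y J i :
  minset (covers (B :* y)) J -> i \in J -> B \subset H i -> J = [set i].
Proof.
move=> minJ Ji sBH; have [w eqB eqH] := minset_covers_meet minJ Ji.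
have [_ min] := minsetP minJ; apply/esym/min; last by rewrite sub1set.
by rewrite /covers big_set1 eqB eqH mulSg.
Qed.

Lemma minset_covers_neq0 B y J :
  minset (covers (B :* y)) J -> exists j, j \in J.
Proof.
case/minsetP=> covJ _.
by have /bigcupP[j Jj _] := subsetP covJ y (rcoset_refl _ _); exists j.
Qed.

Lemma minset_covers_setD B y J I :
    B :* y \subset \bigcup_(i in J) (H i :* x i) ->
    (forall i, i \in I -> [disjoint B :* y & H i :* x i]) ->
  exists2 K, minset (covers (B :* y)) K & K \subset J :\: I.
Proof.
move=> covJ disI; have covJI : covers (B :* y) (J :\: I).
  apply/subsetP=> z Bz; have /bigcupP[i Ji Cz] := subsetP covJ z Bz.
  apply/bigcupP; exists i => //; rewrite inE Ji andbT; apply/negP=> Ii.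
  by have /disjointFr/(_ Bz) := disI i Ii; rewrite Cz.
by have [K minK sK] := minset_exists covJI; exists K.
Qed.

Lemma Omega_index_covers B y J : abelian B ->
  minset (covers (B :* y)) J -> Omega #|B : cap_stab B J| < #|J|.
Proof.
have [n leBn] := ubnP #|B|.
elim: n => // n IHn in B y J leBn *; rewrite ltnS in leBn.
move=> abB minJ; have [covJ minJP] := minsetP minJ.
have IH M z K : M \proper B -> minset (covers (M :* z)) K ->
    Omega #|M : cap_stab M K| < #|K|.
  move=> ltMB; apply: IHn; first exact: leq_trans (proper_card ltMB) leBn.
  exact: abelianS (proper_sub ltMB) abB.
have [j Jj] := minset_covers_neq0 minJ.
have [sBHj|nsBHj] := boolP (B \subset H j).
  rewrite (minset_covers_sub minJ Jj sBHj) cards1.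
  have -> : cap_stab B [set j] = B.
    by apply: val_inj; rewrite /= big_set1; apply/setIidPl.
  by rewrite indexgg Omega1.
(* [I != J] forces at least one enlargement below, which makes the weak bound strict; properness
   lets the induction hypothesis apply to [cap_stab B I]. *)
have [I [sIJ neIJ ltDB leI]] : exists I, [/\ I \subset J, I != J,
    cap_stab B I \proper B & Omega #|B : cap_stab B I| <= #|I|].
  have [w eqB eqH] := minset_covers_meet minJ Jj.
  have [eBH|[M maxM sBHM]] := maximal_exists (subsetIl B (H j)).
    by rewrite -eBH subsetIr in nsBHj.
  have ltMB := maxgroupp maxM; have sMB := proper_sub ltMB.
  have [_ [b Bb Mb]] := properP ltMB.
  have sMbw : M :* (b * w) \subset B :* y.
    by rewrite eqB rcosetM mulSg // -(rcoset_id Bb) mulSg.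
  (* If [m * (b * w)] lay in [H j :* w], then [m * b] would lie in [B :&: H j], hence in [M],
     forcing [b] into [M]. *)
  have disj i : i \in [set j] -> [disjoint M :* (b * w) & H i :* x i].
    move/set1P->; rewrite eqH; apply/pred0P=> z /=; apply/andP=> -[].
    case/rcosetP=> m Mm ->; rewrite mem_rcoset mulgA mulgK => Hmb.
    case/negP: Mb; rewrite -(groupMl _ Mm) (subsetP sBHM) // inE Hmb.
    by rewrite groupM // (subsetP sMB).
  have [I minI] := minset_covers_setD (subset_trans sMbw covJ) disj.
  case/subsetD1P=> sIJ Ij; exists I; split=> //.
  - by apply: contraNneq Ij => ->.
  (* Otherwise some [H i] with [i \in I] contains [B], so [J = [set i]] and [j = i] lies in [I]. *)
  - have [i Ii] := minset_covers_neq0 minI.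
    rewrite properE subsetIl; apply/negP; rewrite subsetI => /andP[_ sBD].
    have sBHi : B \subset H i by apply: subset_trans sBD (bigcap_inf i Ii).
    have eJ := minset_covers_sub minJ (subsetP sIJ i Ii) sBHi.
    by case/negP: Ij; move: Jj; rewrite eJ => /set1P->.
  (* The prime index of [M] contributes one, absorbed by the strict inequality for [M]. *)
  have sMD : cap_stab M I \subset cap_stab B I by apply: setSI.
  apply: leq_trans (IH M _ I ltMB minI).
  apply: (@leq_trans (Omega #|B : cap_stab M I|)).
    by rewrite (Omega_indexgM sMD) ?subsetIl ?leq_addr.
  rewrite (Omega_indexgM (subsetIl M _) sMB) Omega_prime //.
  exact: maximal_abelian_index_prime.
(* Enlarge [I] until it equals [J], by induction on the number of missing indices. *)
have [m] := ubnP #|J :\: I|.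
elim: m => // m IHm in I sIJ neIJ ltDB leI *; rewrite ltnS => leJI.
have /subsetPn[z Byz Iz] : ~~ covers (B :* y) I.
  by apply: contraNN neIJ => /minJP/(_ sIJ)->.
have sDz : cap_stab B I :* z \subset B :* y.
  by rewrite -(rcoset_eqP Byz) mulSg ?subsetIl.
(* Translating [z] by [cap_stab B I] cannot move it into a coset which that group preserves. *)
have disj i : i \in I -> [disjoint cap_stab B I :* z & H i :* x i].
  move=> Ii; apply/pred0P=> u /=; apply/andP=> -[].
  case/rcosetP=> d /setIP[_ /bigcapP/(_ i Ii) Hd] -> Cdz.
  case/bigcupP: Iz; exists i => //.
  by move: Cdz; rewrite !mem_rcoset -mulgA groupMl.
have [K minK] := minset_covers_setD (subset_trans sDz covJ) disj.
rewrite subsetD => /andP[sKJ disKI].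
have := IH _ _ _ ltDB minK; rewrite cap_stabU => ltK.
have cardIK : #|I :|: K| = (#|I| + #|K|)%N.
  by apply/eqP; have [_ ->] := leq_card_setU I K; rewrite disjoint_sym.
have sIKJ : I :|: K \subset J by rewrite subUset sIJ.
have ltIK : Omega #|B : cap_stab B (I :|: K)| < #|I :|: K|.
  rewrite (Omega_indexgM (cap_stabS B (subsetUl I K)) (subsetIl _ _)) cardIK.
  by rewrite -addnS leq_add.
have [<- //|neIKJ] := eqVneq (I :|: K) J.
apply: (IHm (I :|: K)) => //.
- exact: sub_proper_trans (cap_stabS B (subsetUl I K)) ltDB.
- exact: ltnW.
apply: leq_trans leJI; apply: proper_card; rewrite properE setDS ?subsetUl //=.
have [k Kk] := minset_covers_neq0 minK; apply/subsetPn; exists k.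
  by rewrite inE (subsetP sKJ) // (disjointFr disKI).
by rewrite !inE Kk orbT.
Qed.

End CosetCoverings.

(** Trivial intersection makes D_J trivial for the full index set, so the index bounded above is the
    order of [A]. *)
Lemma has_coset_covering_Omega (gT : finGroupType) (A : {group gT}) k :
  abelian A -> has_coset_covering A k -> Omega #|A| < k.
Proof.
move=> abA /existsP[H /existsP[x /and3P[_ /andP[/eqP cov irr] /eqP H1]]].
have {}irr := forallP irr.
have minT : minset (covers H x (A :* 1)) [set: 'I_k].
  rewrite mulg1; apply/minsetP; split=> [|J covJ _].
    by rewrite /covers -{1}cov; apply/bigcupsP=> i _; apply: (bigcup_sup i).
  apply/setP=> j; rewrite !inE; apply: contraR (irr j) => Jj.
  rewrite eqEsubset; apply/andP; split.
    by apply/bigcupsP=> i _; rewrite -cov; apply: (bigcup_sup i).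
  apply: subset_trans covJ _; apply/bigcupsP=> i Ji.
  by apply: (bigcup_sup i); apply: contraNneq Jj => <-.
have := Omega_index_covers abA minT; rewrite cardsT card_ord.
suff -> : cap_stab H A [set: 'I_k] = 1%G by rewrite indexg1.
apply: val_inj => /=; under eq_bigl do rewrite in_setT.
by rewrite H1; apply/setIidPr/sub1G.
Qed.

Lemma has_subgroup_covering_coset (gT : finGroupType) (A : {group gT}) k :
  has_subgroup_covering A k -> has_coset_covering A k.
Proof.
case/existsP=> H /and3P[/forallP sHA irr H1].
apply/existsP; exists H; apply/existsP; exists [ffun=> 1].
apply/and3P; split=> //.
  by apply/forallP=> i; rewrite sHA ffunE group1.
rewrite (_ : (fun i => _) = (fun i => H i : {set gT})) //.
by apply/funext=> i; rewrite ffunE mulg1.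
Qed.

Theorem theorem4 (gT : finGroupType) (A : {group gT}) (n : nat)
    (p alpha : 'I_n -> nat) (abelA : abelian A)
    (p_prime : forall i, prime (p i)) (p_inj : injective p)
    (cardA : #|A| = (\prod_(i < n) p i ^ alpha i)%N) :
  (((f A)%:Z)%:E <= g A)%E /\ (1 + \sum_(i < n) alpha i <= f A)%N.
Proof.
rewrite /f; case: ex_minnP => k covk mink; split.
  rewrite /g; case: pselect => [gP|_]; last exact: leey.
  case: ex_minnP => l covl _.
  by rewrite lee_fin lez_nat mink // has_subgroup_covering_coset.
have := has_coset_covering_Omega abelA covk.
rewrite cardA Omega_prod => [|i]; last by rewrite expn_gt0 prime_gt0.
under eq_bigr do rewrite OmegaX ?prime_gt0 // Omega_prime // muln1.
by rewrite add1n.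
Qed.
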